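(* Let $n\ge 1$, let $x\in S^{(n)}$ be a signal, let $\mu=x(-\infty+0)$ be its initial value, let $T>0$, and let $t_0,t_1\in\mathbf{R}$ be such that $$t_0<t_1<t_0+T$$ and $$(-\infty,t_0)\cup[t_1,t_0+T)\cup[t_1+T,t_0+2T)\cup[t_1+2T,t_0+3T)\cup\dots=\mathbf{T}_\mu^x ,$$ that is, $(-\infty,t_0)\cup\bigcup_{k\ge 0}[t_1+kT,\,t_0+(k+1)T)=\mathbf{T}_\mu^x$. For $t'\in\mathbf{R}$ consider the two properties $$\text{(A)}\quad (-\infty,t']\subset\mathbf{T}_{x(-\infty+0)}^x,$$ $$\text{(B)}\quad \forall t\in\mathbf{T}_\mu^x\cap[t',\infty),\ \{t+zT\mid z\in\mathbf{Z}\}\cap[t',\infty)\subset\mathbf{T}_\mu^x .$$ a) For any $t'\in[t_1-T,t_0)$, both (A) and (B) hold; and for any $t'\in\mathbf{R}$ with $t'\notin[t_1-T,t_0)$, at least one of (A), (B) is false. b) For any $T'>0$ and $t''\in\mathbf{R}$ such that $$(-\infty,t'']\subset\mathbf{T}_{x(-\infty+0)}^x$$ and $$\forall t\in\mathbf{T}_\mu^x\cap[t'',\infty),\ \{t+zT'\mid z\in\mathbf{Z}\}\cap[t'',\infty)\subset\mathbf{T}_\mu^x ,$$ we have $T'\ge T$ and $t''\in[t_1-T',t_0)$.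
   Context: $\mathbf{B}=\{0,1\}$ is the two-element field with addition $\oplus$ (modulo 2 sum) and the usual product, and $\mathbf{B}^n$ ($n\ge1$) is the induced linear space. For $A\subset\mathbf{R}$, $\chi_A:\mathbf{R}\to\mathbf{B}$ is the characteristic function of $A$. A (continuous time) signal is a function $x:\mathbf{R}\to\mathbf{B}^n$ of the form $$x(t)=\mu\cdot\chi_{(-\infty,s_0)}(t)\oplus x(s_0)\cdot\chi_{[s_0,s_1)}(t)\oplus\dots\oplus x(s_k)\cdot\chi_{[s_k,s_{k+1})}(t)\oplus\dots\quad\text{for all }t\in\mathbf{R},$$ where $\mu\in\mathbf{B}^n$ and $(s_k)_{k\in\mathbf{N}}$ is a strictly increasing real sequence that is unbounded from above. The set of such functions is denoted $S^{(n)}$. The vector $\mu$ (the constant value of $x$ on $(-\infty,s_0)$) is called the initial value of $x$ and is denoted $x(-\infty+0)$. The orbit of $x$ is $Or(x)=\{x(t)\mid t\in\mathbf{R}\}$, and for $\mu\in Or(x)$ we put $\mathbf{T}_\mu^x=\{t\in\mathbf{R}\mid x(t)=\mu\}$. *)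

(* Defs.v *)
From HB Require Import structures.
From mathcomp Require Import all_boot all_order all_algebra.
From mathcomp Require Import mathcomp_extra boolp classical_sets functions.
From mathcomp Require Import cardinality fsbigop set_interval reals numfun.
Set Implicit Arguments.
Unset Strict Implicit.
Unset Printing Implicit Defensive.
Import Order.TTheory GRing.Theory Num.Theory.

Local Open Scope classical_set_scope.
Local Open Scope ring_scope.

(* B = 'F_2 and B^n = 'rV['F_2]_n. For every t the sum over k has at most one
   nonzero term, since the intervals [s k, s k.+1[ are pairwise disjoint, so the
   finitely supported sum is the formal infinite sum of the usual definition. *)
Definition signal_form (R : realType) (n : nat) (x : R -> 'rV['F_2]_n)
    (mu : 'rV['F_2]_n) (s : nat -> R) : Prop :=
  [/\ {homo s : i j / (i < j)%N >-> i < j},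
      ~ has_ubound (range s) &
      forall t : R, x t = \1_(`]-oo, s 0%N[) t *: mu
        + \sum_(k \in [set: nat]) \1_(`[s k, s k.+1[) t *: x (s k)].

Definition signal (R : realType) (n : nat) : set (R -> 'rV['F_2]_n) :=
  [set x | exists mu s, signal_form x mu s].
Arguments signal : clear implicits.

(* x(-oo + 0). A signal has exactly one such mu (all its forms agree near -oo);
   the default value 0 is only taken when x is not a signal. *)
Definition initial_value (R : realType) (n : nat) (x : R -> 'rV['F_2]_n) :
    'rV['F_2]_n :=
  xget 0 [set mu | exists s, signal_form x mu s].

Definition time_set (R : realType) (n : nat) (x : R -> 'rV['F_2]_n)
    (mu : 'rV['F_2]_n) : set R :=
  [set t | x t = mu].

Definition initially_constant (R : realType) (n : nat) (x : R -> 'rV['F_2]_n)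
    (t' : R) : Prop :=
  `]-oo, t'] `<=` time_set x (initial_value x).

Definition periodic_from (R : realType) (n : nat) (x : R -> 'rV['F_2]_n)
    (mu : 'rV['F_2]_n) (T t' : R) : Prop :=
  forall t, (time_set x mu `&` `[t', +oo[) t ->
    [set t + z%:~R * T | z in [set: int]] `&` `[t', +oo[ `<=` time_set x mu.

(* Main.v *)
Require Import Defs.
From mathcomp Require Import all_boot all_order all_algebra.
From mathcomp Require Import boolp classical_sets set_interval reals.
From mathcomp Require Import lra.
Import Order.TTheory GRing.Theory Num.Theory.
Local Open Scope classical_set_scope.
Local Open Scope ring_scope.

(** Only the time set of the initial value matters: it is the set [P] made of
    the half-line before [t0] and of the intervals [t1 + kT, t0 + (k+1)T[ with
    [k] a natural number, separated by gaps of length [t1 - t0 < T], the first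
    of which is [t0, t1[.

    Sufficiency.  From [t1 - T] on, the half-line contributes exactly the
    interval with index [k = -1], and the intervals with [k < -1] lie before
    [t1 - T].  So there [P] is the trace of the [T]-periodic union of these
    intervals over all integers [k] (lemma [pulse_trainE]); hence [P] is
    periodic from any [t'] in [t1 - T, t0[ (lemma [pulse_train_shift]).

    Necessity.  Suppose that the half-line up to [t''] lies in [P] and that [P]
    has period [T'] from [t''].  Then [t'' < t0] because [t0] is in a gap.
    If [t''] were less than [t1 - T'], some point of the first gap [t0, t1[
    would be the image under the shift by [T'] of a point of [t'', t0[, hence
    would be in [P] (lemma [period_start_ge]).  Therefore [t1 - T' <= t'' < t0],
    so that [T' > t1 - t0]; if moreover [T' < T], then [t0 + T'] is in
    [t1, t0 + T[, a part of [P], and shifting back by [T'] puts [t0] in [P]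
    (lemma [period_ge]).

    The negative half of a) is the bound on [t''] for [T' = T]. *)

Set Implicit Arguments.
Unset Strict Implicit.

Section PulseTrain.
Variables (R : realType) (T t0 t1 : R).
Hypotheses (T_gt0 : 0 < T) (t01 : t0 < t1).

Definition pulse_train : set R :=
  `]-oo, t0[ `|`
  \bigcup_(k in [set: nat]) `[t1 + k%:R * T, t0 + k.+1%:R * T[%classic.

Lemma pulse_trainP (t : R) :
  pulse_train t <->
  t < t0 \/ exists k : nat, t1 + k%:R * T <= t < t0 + k.+1%:R * T.
Proof.
split=> [[|[k _]]|[tt0|[k tk]]]; rewrite /= ?in_itv /=.
- by left.
- by right; exists k.
- by left; rewrite /= in_itv.
- by right; exists k; rewrite //= in_itv.
Qed.

Lemma pulse_train_first_gap (t : R) : t0 <= t < t1 -> ~ pulse_train t.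
Proof.
move=> /andP[t0t tt1] /pulse_trainP[|[k /andP[t1t _]]]; first lra.
have : 0 <= k%:R * T by rewrite mulr_ge0 ?ler0n ?ltW.
lra.
Qed.

Lemma pulse_train_first_pulse (t : R) : t1 <= t < t0 + T -> pulse_train t.
Proof.
by move=> tI; apply/pulse_trainP; right; exists 0%N; rewrite mul0r addr0 mul1r.
Qed.

(** To the right of [t1 - T] the half-line is seen only through
    [t1 - T, t0[, the interval with index [-1], and an interval with index
    below [-1] ends before [t1 - T]; so all integer indices can be allowed,
    which makes the set visibly periodic. *)
Lemma pulse_trainE (t : R) : t1 - T <= t ->
  pulse_train t <->
  exists k : int, t1 + k%:~R * T <= t < t0 + (k%:~R + 1) * T.
Proof.
move=> tge; split=> [/pulse_trainP[tt0|[k tk]]|[k /andP[lek ltk]]].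
- exists (-1); rewrite mulrN1z; apply/andP; split; lra.
- by exists k%:Z; rewrite -pmulrn -mulrSr.
apply/pulse_trainP; case: k lek ltk => k lek ltk.
  by right; exists k; rewrite mulrSr; apply/andP.
left; move: ltk; rewrite NegzE mulrNz -pmulrn mulrSr.
have : 0 <= k%:R * T by rewrite mulr_ge0 ?ler0n ?ltW.
lra.
Qed.

(** A shift by [zT] moves the interval with index [k] to the one with index
    [k + z]. *)
Lemma pulse_train_shift (t : R) (z : int) :
  t1 - T <= t -> t1 - T <= t + z%:~R * T ->
  pulse_train t -> pulse_train (t + z%:~R * T).
Proof.
move=> tge tzge /(pulse_trainE tge)[k /andP[lek ltk]].
apply/(pulse_trainE tzge); exists (k + z).
by rewrite intrD; apply/andP; split; lra.
Qed.

Section Necessity.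
Variables (T' t'' : R).
Hypothesis T'_gt0 : 0 < T'.
Hypothesis initial : `]-oo, t''] `<=` pulse_train.
Hypothesis periodic : forall t (z : int),
  pulse_train t -> t'' <= t -> t'' <= t + z%:~R * T' ->
  pulse_train (t + z%:~R * T').

Lemma period_start_lt : t'' < t0.
Proof.
rewrite ltNge; apply/negP => t0t''.
apply: (@pulse_train_first_gap t0); first by rewrite lexx t01.
by apply: initial; rewrite /= in_itv.
Qed.

(** Otherwise the shift by [T'] would carry a point of the initial half-line
    into the first gap. *)
Lemma period_start_ge : t1 - T' <= t''.
Proof.
have t''t0 := period_start_lt; rewrite leNgt; apply/negP => t''t1.
(* [u] is the first point of the gap [t0, t1[ whose predecessor [u - T'] is
   in the zone of periodicity. *)
pose u := Num.max t0 (t'' + T').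
have t0u : t0 <= u by rewrite le_max lexx.
have t''u : t'' + T' <= u by rewrite le_max lexx orbT.
have ut1 : u < t1 by rewrite gt_max t01 /=; lra.
have ut0 : u < t0 + T' by rewrite gt_max ltrDl T'_gt0 ltrD2r.
apply: (@pulse_train_first_gap u); first exact/andP.
have -> : u = (u - T') + 1%:~R * T' by rewrite mul1r subrK.
by apply: periodic; [apply/pulse_trainP; left; lra | lra | lra].
Qed.

(** By the two bounds on [t''], a period is longer than the first gap; one
    shorter than [T] would then carry [t0], which is in the gap, into the pulse
    [t1, t0 + T[ that follows it. *)
Lemma period_ge : T <= T'.
Proof.
have t''t0 := period_start_lt; have t1t'' := period_start_ge.
rewrite leNgt; apply/negP => T'T.
apply: (@pulse_train_first_gap t0); first by rewrite lexx t01.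
have back : t0 + T' + (-1)%:~R * T' = t0 by rewrite mulrN1z mulN1r addrK.
rewrite -[X in pulse_train X]back.
apply: periodic; rewrite ?back; [|by rewrite ltW // ltr_wpDr // ltW|exact: ltW].
by apply: pulse_train_first_pulse; apply/andP; split; lra.
Qed.

End Necessity.

End PulseTrain.

Lemma periodic_fromP (R : realType) (n : nat) (x : R -> 'rV['F_2]_n)
    (mu : 'rV['F_2]_n) (T t' : R) :
  periodic_from x mu T t' <->
  forall t (z : int), time_set x mu t -> t' <= t -> t' <= t + z%:~R * T ->
    time_set x mu (t + z%:~R * T).
Proof.
split=> per t.
  move=> z xt t't t'tz; apply: (per t).
    by split; rewrite //= in_itv /= t't.
  by split; [exists z | rewrite /= in_itv /= t'tz].
move=> [xt]; rewrite /= in_itv /= andbT => t't _ [[z _ <-]].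
by rewrite /= in_itv /= andbT; apply: per.
Qed.

Unset Implicit Arguments.
Set Strict Implicit.

Theorem theorem9 (R : realType) (n : nat) (hn : (1 <= n)%N)
    (x : R -> 'rV['F_2]_n) (hx : signal R n x)
    (mu : 'rV['F_2]_n) (hmu : mu = initial_value x)
    (T : R) (hT : 0 < T) (t0 t1 : R) (ht01 : t0 < t1) (ht1 : t1 < t0 + T)
    (hTmu : `]-oo, t0[ `|`
        \bigcup_(k in [set: nat]) `[t1 + k%:R * T, t0 + k.+1%:R * T[%classic
      = time_set x mu) :
  ((forall t' : R, t1 - T <= t' < t0 ->
      initially_constant x t' /\ periodic_from x mu T t') /\
   (forall t' : R, ~ (t1 - T <= t' < t0) ->
      ~ initially_constant x t' \/ ~ periodic_from x mu T t')) /\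
  (forall T' t'' : R, 0 < T' ->
      initially_constant x t'' -> periodic_from x mu T' t'' ->
      T <= T' /\ t1 - T' <= t'' < t0).
Proof.
have xE : pulse_train T t0 t1 = time_set x mu := hTmu.
have nec (T' t'' : R) : 0 < T' ->
    initially_constant x t'' -> periodic_from x mu T' t'' ->
    T <= T' /\ t1 - T' <= t'' < t0.
  rewrite /initially_constant -hmu => T'_gt0 + /periodic_fromP.
  rewrite -xE => init per; split.
    exact: (period_ge hT ht01 T'_gt0 init per).
  apply/andP; split; first exact: (period_start_ge hT ht01 T'_gt0 init per).
  exact: (period_start_lt hT ht01 init).
split=> //; split=> t'.
  move=> /andP[t1t' t't0]; split.
    rewrite /initially_constant -hmu -xE => t; rewrite /= in_itv /= => tt'.
    by apply/pulse_trainP; left; apply: le_lt_trans t't0.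
  apply/periodic_fromP; rewrite -xE => t z xt t't t'tz.
  by apply: pulse_train_shift => //; lra.
move=> t'N; apply/not_andP => -[init per]; apply: t'N.
by have [] := nec T t' hT init per.
Qed.
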